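(* Let $k\ge3$ be an integer, $a\ne0$ a constant, and let $\mathcal{Z}$ be the twistor space with patching relations $$\widetilde{Q}=\lambda^{-k}Q,\qquad \tilde{\tau}=\lambda^{k-2}\tau+a\lambda^{-2}Q^2,\qquad\tilde\lambda=\lambda^{-1}.$$ Then for every integer $i$ with $(k+1)/2\le i\le k-1$ if $k$ is odd, or $k/2\le i\le k-1$ if $k$ is even, there are holomorphic sections of $\mathcal{Z}\to\mathbb{CP}^1$ with normal bundle $\mathcal{O}(2-i)\oplus\mathcal{O}(i)$, namely those with $x_i\neq0$ and $x_j=0$ for all other $j$ in the range $0\le j\le k-1$. Moreover the sections with $x_0\neq0$ and $x_j=0$ for $1\le j\le k-1$ have normal bundle $\mathcal{O}\oplus\mathcal{O}(2)$.
   Context: $\mathcal{O}(m)$ is the holomorphic line bundle over $\mathbb{CP}^1$ of Chern class $m$, with patching function $\lambda^{-m}$, and $\mathcal{O}=\mathcal{O}(0)$. $\mathcal{Z}$ is the complex three-fold obtained by gluing $\{(\lambda,Q,\tau)\}$ and $\{(\tilde\lambda,\widetilde Q,\tilde\tau)\}$, $\tilde\lambda=\lambda^{-1}$, by the stated relations; it fibres over $\mathbb{CP}^1$ by $\lambda$. A holomorphic section restricts $Q$ to $Q=x_k\lambda^k+\dots+x_1\lambda+x_0$; such a $Q$ lifts to a (unique) holomorphic section of $\mathcal{Z}\to\mathbb{CP}^1$ iff the coefficients of $\lambda^n$ in $Q^2$ vanish for $3\le n\le k-1$, i.e. $x_0x_n+x_1x_{n-1}+\dots=0$ for $3\le n\le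 k-1$. The coordinate $x_k$ is arbitrary. *)

(* Defs.v *)
(* The complex numbers are R[i], for an arbitrary model R of the reals. *)
From HB Require Import structures.
From mathcomp Require Import all_boot all_order all_algebra.
From mathcomp Require Import complex.
From mathcomp Require Import all_classical all_reals all_analysis.
Import Order.TTheory GRing.Theory Num.Theory.
Import numFieldNormedType.Exports.

Set Implicit Arguments.
Unset Strict Implicit.
Unset Printing Implicit Defensive.

Local Open Scope ring_scope.
Local Open Scope classical_set_scope.

(* R[i] packed as a numFieldType, so that it receives the topology
   and norm that every numFieldType has over itself. *)
Definition Cplx (R : realType) : numFieldType := R[i].

Definition holomorphic (R : realType) (m n : nat)
    (f : Cplx R -> 'M[Cplx R]_(m, n)) : Prop :=
  forall z, differentiable f z.

(* CP^1 is covered by the charts l and l^-1, each a copy of C.  A rank r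
   holomorphic vector bundle is trivial over each chart and is given by its
   transition matrix g on l != 0: the row vector v of fibre coordinates over
   the chart l becomes v *m g l over the chart l^-1.  The value g 0 is
   irrelevant. *)
Definition bundle (R : realType) (r : nat) : Type := Cplx R -> 'M[Cplx R]_r.

Definition line_bundle (R : realType) (m : int) : bundle R 1 :=
  fun l => (l ^ (- m))%:M.

Definition bundle_sum (R : realType) (r s : nat)
    (g : bundle R r) (h : bundle R s) : bundle R (r + s) :=
  fun l => block_mx (g l) 0 0 (h l).

(* A three-fold fibring over CP^1 is glued from two copies of C^3, whose 0-th
   coordinate is the coordinate of CP^1, by a map F defined where that
   coordinate is nonzero; the values of F elsewhere are irrelevant.  A
   holomorphic section, seen in the two charts, is a pair of holomorphic maps
   matched by F. *)
Record hol_section (R : realType) (F : 'rV[Cplx R]_3 -> 'rV[Cplx R]_3) := {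
  sec : Cplx R -> 'rV[Cplx R]_3;
  sec_inf : Cplx R -> 'rV[Cplx R]_3;
  sec_holo : holomorphic sec;
  sec_inf_holo : holomorphic sec_inf;
  sec_proj : forall l, sec l 0 0 = l;
  sec_inf_proj : forall l, sec_inf l 0 0 = l;
  sec_patch : forall l, l != 0 -> F (sec l) = sec_inf l^-1
}.

(* The normal bundle of the image S of s is TZ|_S / TS.  Here TZ|_S has rank 3
   and transition matrix 'J F (s l), and TS is spanned in the two charts by the
   velocities of s.  The bundle g is (isomorphic to) the normal bundle when
   there is an exact sequence 0 -> TS -> TZ|_S -> g -> 0; the map
   TZ|_S -> g is v |-> v *m p l over the chart l and v |-> v *m q l over the
   chart l^-1. *)
Definition has_normal_bundle (R : realType)
    (F : 'rV[Cplx R]_3 -> 'rV[Cplx R]_3) (s : hol_section F)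
    (r : nat) (g : bundle R r) : Prop :=
  exists p q : Cplx R -> 'M[Cplx R]_(3, r),
    [/\ holomorphic p /\ holomorphic q,
        forall l, l != 0 -> 'J F (sec s l) *m q l^-1 = p l *m g l,
        forall l, row_full (p l) /\ (kermx (p l) == (sec s)^`() l)%MS
      & forall l, row_full (q l) /\ (kermx (q l) == (sec_inf s)^`() l)%MS].

(* Coordinates are ordered (lambda, Q, tau). *)
Definition twistor_patching (R : realType) (k : nat) (a : Cplx R)
    (z : 'rV[Cplx R]_3) : 'rV[Cplx R]_3 :=
  let l := z 0 0 in let Q := z 0 1 in let tau := z 0 2 in
  \row_(j < 3) [:: l^-1;
                   l ^ (- k%:Z) * Q;
                   l ^ (k%:Z - 2) * tau + a * l ^ (- 2%:Z) * Q ^+ 2]`_j.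

(* The section restricts Q to x_k l^k + ... + x_1 l + x_0, with x_j = x`_j. *)
Definition section_coefs (R : realType) (k : nat) (a : Cplx R)
    (s : hol_section (twistor_patching k a)) (x : {poly Cplx R}) : Prop :=
  (size x <= k.+1)%N /\ forall l, sec s l 0 1 = x.[l].

(* Main.v *)
Require Import Defs.
From HB Require Import structures.
From mathcomp Require Import all_boot all_order all_algebra.
From mathcomp Require Import complex ring lra zify.
From mathcomp Require Import all_classical all_reals all_analysis.
Import Order.TTheory GRing.Theory Num.Theory.
Import numFieldNormedType.Exports.
Local Open Scope ring_scope.

(** Along a section the tangent bundle of the three-fold splits off its
    vertical part: v is sent to its (Q, tau)-component minus the multiple of
    the velocity of the section with the same lambda-component.  So the normal
    bundle has as transition matrix the (Q, tau)-block of the Jacobian,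
      M(l) = [[l^-k, 2 a l^-2 Q], [0, l^(k-2)]],
    acting on row vectors (dQ, dtau).
    For Q = e l^i + d l^k, row and column operations, polynomial in l on the
    left and in l^-1 on the right, bring M to diag (l^(i-2), l^-i): subtracting
    2 a d times row 2 from row 1 removes the term d l^k; then c l^(i-2), with
    c = 2 a e, clears l^(k-2) from below it because k - i >= 0, and l^-k from
    beside it because k + i - 2 >= 0.  This gives O(2-i) + O(i) for every i <= k
    (normal_bundle_binomial); i = 0 is the second half of the theorem.
    A Q of this form lifts to a section when each monomial of a l^-2 Q^2 is a
    multiple of l^(k-2) or has a nonpositive exponent; the only one in doubt,
    a e^2 l^(2i-2), is of the first kind if 2 i >= k and of the second if
    i = 0 (binomial_matched).

    The frames contain the velocity of the section, so tau must have a
    holomorphic derivative, whereas a section is only assumed to be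
    complex-differentiable.  It is therefore shown that tau is determined by Q,
    hence a polynomial (section_unique): the difference u of two lifts and the
    corresponding difference v at infinity satisfy l^(k-2) u(l) = v(l^-1), and
    Liouville's theorem forces both to vanish (liouville_at_infinity).

    Liouville's theorem for functions that are merely differentiable is proved
    from Goursat's lemma.  Contour integrals around squares are replaced by
    trapezoid sums with 3^n steps per side: these are exactly additive when a
    square is cut in nine (square_sumS) and vanish exactly on affine functions
    (square_sum_affine), which is what makes the nested-squares argument work.
    If h is entire and tends to 0 at infinity while h(w) is nonzero, then
    F(z) = (1 - h(z) / h(w)) / (z - w) is bounded near w and differentiable
    elsewhere, so its sums around each square centred at w tend to 0 under
    refinement; but far away F is close to 1 / (z - w), so that around a large
    square all its sums have imaginary part at least 2 (entire_vanishing). *)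

Set Implicit Arguments.
Unset Strict Implicit.
Unset Printing Implicit Defensive.

(* Keeps /= from unfolding Cplx R to R[i], which would hide its topology. *)
#[local] Arguments Cplx : simpl never.

(** * Liouville's theorem without integrals *)

Section Liouville.
Variable R : realType.
Local Notation C := (Cplx R).
Local Notation nrm := (@Normc.normc R : C -> R).
Local Notation Im := (@complex.Im R : C -> R).
Local Notation "x %:C" := (real_complex R x : C) : ring_scope.
Local Notation I := ('i%C : C).
Implicit Types (F G h : C -> C) (z w v : C) (x y s t e : R).

Lemma nrmE z : `|z| = (nrm z)%:C. Proof. by []. Qed.
Lemma nrmM z w : nrm (z * w) = nrm z * nrm w. Proof. exact: Normc.normcM. Qed.
Lemma nrmD z w : nrm (z + w) <= nrm z + nrm w. Proof. exact: le_normcD. Qed.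
Lemma nrmN z : nrm (- z) = nrm z. Proof. exact: normcN. Qed.
Lemma nrmV z : nrm z^-1 = (nrm z)^-1. Proof. exact: Normc.normcV. Qed.
Lemma nrmR x : nrm x%:C = `|x|.
Proof. by rewrite /= expr0n addr0 sqrtr_sqr. Qed.
Lemma nrmi : nrm ('i%C : C) = 1.
Proof. by rewrite /= expr0n expr1n add0r sqrtr1. Qed.
Lemma nrm0 : nrm 0 = 0. Proof. exact: Normc.normc0. Qed.
Lemma nrm_ge0 z : 0 <= nrm z.
Proof. by case: z => a b /=; rewrite sqrtr_ge0. Qed.
Lemma nrm_eq0 z : (nrm z == 0) = (z == 0).
Proof.
by apply/eqP/eqP => [/Normc.eq0_normc//|->]; exact: nrm0.
Qed.

Lemma ImD z w : Im (z + w) = Im z + Im w.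
Proof. by move: z w => [a b] [c d]. Qed.
Lemma ImRM x z : Im (x%:C * z) = x * Im z.
Proof. by case: z => a b /=; rewrite mul0r addr0. Qed.
Lemma Im_nrm z : `|Im z| <= nrm z.
Proof.
case: z => a b /=; rewrite -sqrtr_sqr ler_wsqrtr// lerDr sqr_ge0 //.
Qed.

(** Trapezoid rule for the mean of F over the segment from z to z + v, with 3^n
    equal steps.  The recursion by thirds makes the sums compatible with the
    subdivision of a square into nine. *)
Fixpoint segment_mean F n z v : C :=
  if n is n'.+1 then
    (segment_mean F n' z (v / 3) + segment_mean F n' (z + v / 3) (v / 3)
     + segment_mean F n' (z + v / 3 + v / 3) (v / 3)) / 3
  else (F z + F (z + v)) / 2.

(** A mean of values of F stays in every convex set that contains them; the two
    closure conditions are those that the trapezoid rule uses.  Discs give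
    norm bounds and half-planes give bounds on imaginary parts. *)
Lemma segment_mean_convex (K : C -> Prop) F n z v :
  (forall u w, K u -> K w -> K ((u + w) / 2)) ->
  (forall u w p, K u -> K w -> K p -> K ((u + w + p) / 3)) ->
  (forall t, 0 <= t <= 1 -> K (F (z + t%:C * v))) ->
  K (segment_mean F n z v).
Proof.
move=> K2 K3; elim: n z v => [|n IH] z v KF /=.
  apply: K2; first by have := KF 0; rewrite mul0r addr0; apply; lra.
  by have := KF 1; rewrite mul1r; apply; lra.
apply: K3; apply: IH => t ht.
- have -> : z + t%:C * (v / 3) = z + (t / 3)%:C * v by field.
  by apply: KF; lra.
- have -> : z + v / 3 + t%:C * (v / 3) = z + ((t + 1) / 3)%:C * v by field.
  by apply: KF; lra.
- have -> : z + v / 3 + v / 3 + t%:C * (v / 3) = z + ((t + 2) / 3)%:C * v by field.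
  by apply: KF; lra.
Qed.

Lemma segment_mean_norm_le F n z v M :
  (forall t, 0 <= t <= 1 -> nrm (F (z + t%:C * v)) <= M) ->
  nrm (segment_mean F n z v) <= M.
Proof.
apply: (@segment_mean_convex (fun w => nrm w <= M)) => [u w|u w p] hu hw => [|hp].
  rewrite nrmM nrmV -[2]/(2%:R) -(rmorph_nat (real_complex R)) nrmR normr_nat.
  by have := nrmD u w; lra.
rewrite nrmM nrmV -(rmorph_nat (real_complex R)) nrmR normr_nat.
by have := nrmD (u + w) p; have := nrmD u w; lra.
Qed.

Lemma segment_meanD F G n z v :
  segment_mean (fun w => F w + G w) n z v = segment_mean F n z v + segment_mean G n z v.
Proof. by elim: n z v => [|n IH] z v /=; rewrite ?IH; field. Qed.

Lemma segment_mean_affine c0 c1 n z v :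
  segment_mean (fun w : C => c0 + c1 * w) n z v = c0 + c1 * (z + v / 2).
Proof. by elim: n z v => [|n IH] z v /=; rewrite ?IH; field. Qed.

Definition segment_sum F n z v := v * segment_mean F n z v.

Lemma segment_sumS F n z v :
  segment_sum F n.+1 z (3 * v) =
    segment_sum F n z v + segment_sum F n (z + v) v + segment_sum F n (z + v + v) v.
Proof.
rewrite /segment_sum /= (_ : 3 * v / 3 = v); first by field.
by rewrite mulrAC divff ?mul1r// pnatr_eq0.
Qed.

Definition pt x y : C := x%:C + I * y%:C.

(** Counterclockwise trapezoid sum of F dz around the square with lower left
    corner x + iy and side s. *)
Definition square_sum F n x y s :=
  segment_sum F n (pt x y) s%:C + segment_sum F n (pt (x + s) y) (I * s%:C)
  - segment_sum F n (pt x (y + s)) s%:C - segment_sum F n (pt x y) (I * s%:C).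

(** The twelve inner sides of the nine squares are each run through twice, in
    opposite directions, with the same subdivision points. *)
Lemma square_sumS F n x y s :
  square_sum F n.+1 x y (3 * s) =
  \sum_(i < 3) \sum_(j < 3) square_sum F n (x + i%:R * s) (y + j%:R * s) s.
Proof.
rewrite !big_ord_recr !big_ord0 /= /square_sum.
rewrite (_ : (3 * s)%:C = 3 * s%:C); last by rewrite rmorphM rmorph_nat.
rewrite (mulrCA I) !segment_sumS.
have e1 a b : pt a b + s%:C = pt (a + s) b by rewrite /pt; ring.
have e2 a b : pt a b + I * s%:C = pt a (b + s) by rewrite /pt; ring.
rewrite !e1 !e2.
have -> : x + 0 * s = x by ring.
have -> : y + 0 * s = y by ring.
have -> : x + 1 * s = x + s by ring.
have -> : y + 1 * s = y + s by ring.
have -> : x + 2 * s = x + s + s by ring.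
have -> : y + 2 * s = y + s + s by ring.
have -> : x + 3 * s = x + s + s + s by ring.
have -> : y + 3 * s = y + s + s + s by ring.
ring.
Qed.

Lemma square_sumD F G n x y s :
  square_sum (fun w => F w + G w) n x y s = square_sum F n x y s + square_sum G n x y s.
Proof. by rewrite /square_sum /segment_sum !segment_meanD; ring. Qed.

(** The trapezoid rule is exact on affine functions, which have primitives. *)
Lemma square_sum_affine c0 c1 n x y s :
  square_sum (fun w : C => c0 + c1 * w) n x y s = 0.
Proof.
by rewrite /square_sum /segment_sum !segment_mean_affine /pt; field.
Qed.

Lemma square_sum_norm_le F n x y s M : 0 <= s ->
  (forall a b, 0 <= a <= s -> 0 <= b <= s -> nrm (F (pt (x + a) (y + b))) <= M) ->
  nrm (square_sum F n x y s) <= 4 * s * M.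
Proof.
move=> s0 FM.
have nI : nrm (I * s%:C) = s by rewrite nrmM nrmi mul1r nrmR ger0_norm.
have nS : nrm s%:C = s by rewrite nrmR ger0_norm.
have E z v : nrm v = s ->
    (forall t, 0 <= t <= 1 -> nrm (F (z + t%:C * v)) <= M) ->
    nrm (segment_sum F n z v) <= s * M.
  move=> nv Fv; rewrite /segment_sum nrmM nv ler_wpM2l//.
  exact: segment_mean_norm_le.
have ts t : 0 <= t <= 1 -> 0 <= t * s <= s.
  by move=> /andP[t0 t1]; rewrite mulr_ge0//= ler_piMl.
have H1 b t : 0 <= b <= s -> 0 <= t <= 1 ->
    nrm (F (pt x (y + b) + t%:C * s%:C)) <= M.
  move=> hb /ts ht; rewrite (_ : _ + _ = pt (x + t * s) (y + b)); first exact: FM.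
  by rewrite /pt; ring.
have H2 b t : 0 <= b <= s -> 0 <= t <= 1 ->
    nrm (F (pt (x + b) y + t%:C * (I * s%:C))) <= M.
  move=> hb /ts ht; rewrite (_ : _ + _ = pt (x + b) (y + t * s)); first exact: FM.
  by rewrite /pt; ring.
have z0 : 0 <= (0 : R) <= s by rewrite lexx s0.
have zs : 0 <= s <= s by rewrite lexx s0.
have E1 : nrm (segment_sum F n (pt x y) s%:C) <= s * M.
  by apply: E => // t ht; have := H1 0 t z0 ht; rewrite addr0.
have E2 : nrm (segment_sum F n (pt (x + s) y) (I * s%:C)) <= s * M.
  by apply: E => // t ht; exact: H2.
have E3 : nrm (segment_sum F n (pt x (y + s)) s%:C) <= s * M.
  by apply: E => // t ht; exact: H1.
have E4 : nrm (segment_sum F n (pt x y) (I * s%:C)) <= s * M.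
  by apply: E => // t ht; have := H2 0 t z0 ht; rewrite addr0.
rewrite /square_sum; apply: le_trans (nrmD _ _) _; rewrite nrmN.
have := nrmD (segment_sum F n (pt x y) s%:C + segment_sum F n (pt (x + s) y) (I * s%:C))
  (- segment_sum F n (pt x (y + s)) s%:C); rewrite nrmN.
have := nrmD (segment_sum F n (pt x y) s%:C) (segment_sum F n (pt (x + s) y) (I * s%:C)).
lra.
Qed.

(** Stated with real tolerances because norms on C are complex numbers, whose
    order is only partial. *)
Definition cdiff F z := exists D : C, forall e, 0 < e -> exists2 d : R, 0 < d &
  forall w, nrm (w - z) < d -> nrm (F w - F z - D * (w - z)) <= e * nrm (w - z).

Definition square_sum_vanishes F x y s := forall e, 0 < e -> exists n0 : nat,
  forall n, (n0 <= n)%N -> nrm (square_sum F n x y s) <= e.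

Lemma nrm_sum n (f : 'I_n -> C) : nrm (\sum_i f i) <= \sum_i nrm (f i).
Proof.
elim/big_ind2: _ => [|c a d b h1 h2|//]; first by rewrite nrm0.
by have := nrmD a b; lra.
Qed.

Lemma nrm_pt x y : nrm (pt x y) <= `|x| + `|y|.
Proof.
by apply: le_trans (nrmD _ _) _; rewrite nrmM nrmi mul1r !nrmR.
Qed.

Lemma nested_squares (x y : nat -> R) (s : R) : 0 < s ->
  (forall n, exists i j : 'I_3,
     x n.+1 = x n + i%:R * (s / 3 ^+ n.+1) /\ y n.+1 = y n + j%:R * (s / 3 ^+ n.+1)) ->
  exists X Y, forall n, x n <= X <= x n + s / 3 ^+ n /\ y n <= Y <= y n + s / 3 ^+ n.
Proof.
move=> s0 H.
have I1 (u : nat -> R) : (forall n, exists i : 'I_3, u n.+1 = u n + i%:R * (s / 3 ^+ n.+1)) ->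
   exists X, forall n, u n <= X <= u n + s / 3 ^+ n.
  move=> Hu.
  have p n : 0 < s / 3 ^+ n by rewrite divr_gt0// exprn_gt0.
  have step n : u n <= u n.+1 /\ u n.+1 + s / 3 ^+ n.+1 <= u n + s / 3 ^+ n.
    have [i ->] := Hu n; have := p n.+1.
    have -> : s / 3 ^+ n = 3 * (s / 3 ^+ n.+1).
      by rewrite exprS; field; rewrite expf_neq0// pnatr_eq0.
    set q := s / _ => q0; clearbody q.
    by case: i => [[|[|[|//]]] hi] /=; split; lra.
  have mono n m : u n <= u (n + m)%N /\
      u (n + m)%N + s / 3 ^+ (n + m) <= u n + s / 3 ^+ n.
    elim: m => [|m IH]; first by rewrite addn0.
    by rewrite addnS; have := step (n + m)%N; lra.
  have ub n m : u m <= u n + s / 3 ^+ n.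
    have [/subnKC <-|/ltnW/subnKC <-] := leqP n m.
      by have := mono n (m - n)%N; have := p (n + (m - n))%N; lra.
    by have := mono m (n - m)%N; have := p (m + (n - m))%N; lra.
  exists (sup (range u)) => n; apply/andP; split.
    apply: ub_le_sup; last by exists n.
    by exists (u 0%N + s / 3 ^+ 0) => _ [m _ <-]; exact: ub.
  by apply: ge_sup; [exists (u 0%N), 0%N|move=> _ [m _ <-]; exact: ub].
have [|X hX] := I1 x; first by move=> n; have [i [j []]] := H n; exists i.
have [|Y hY] := I1 y; first by move=> n; have [i [j []]] := H n; exists j.
by exists X, Y => n; split.
Qed.

(** On a small square around z the affine part of F contributes nothing, and
    the remainder is at most e / 8 times the diameter 2 s, along a perimeter
    4 s. *)
Lemma square_sum_small F z e : 0 < e -> cdiff F z ->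
  exists2 d : R, 0 < d & forall n x y s, 0 < s -> 2 * s < d ->
    (exists a b, [/\ 0 <= a <= s, 0 <= b <= s & z = pt (x + a) (y + b)]) ->
    nrm (square_sum F n x y s) <= e * s ^+ 2.
Proof.
move=> e0 [D /(_ (e / 8))[|d d0 Hd]]; first by lra.
exists d => // n x y s s0 sd [a [b [/andP[a0 a1] /andP[b0 b1] zE]]].
pose G w := F w - F z - D * (w - z).
have -> : F = (fun w => ((F z - D * z) + D * w) + G w).
  by apply/funext => w; rewrite /G; ring.
rewrite square_sumD square_sum_affine add0r.
have -> : e * s ^+ 2 = 4 * s * (e / 8 * (2 * s)) by field.
apply: square_sum_norm_le; first exact: ltW.
move=> a' b' /andP[a'0 a'1] /andP[b'0 b'1].
have dist : nrm (pt (x + a') (y + b') - z) <= 2 * s.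
  have -> : pt (x + a') (y + b') - z = pt (a' - a) (b' - b).
    by rewrite zE /pt; ring.
  apply: le_trans (nrm_pt _ _) _.
  have : `|a' - a| <= s by rewrite ler_norml; lra.
  have : `|b' - b| <= s by rewrite ler_norml; lra.
  by lra.
apply: le_trans (Hd _ _) _; first by lra.
by rewrite ler_wpM2l//; lra.
Qed.

(** Goursat's argument: if the sums around a square exceed e times its area
    for arbitrarily fine subdivisions, so do those around one of its nine
    parts; the nested squares obtained in this way shrink to a point where
    square_sum_small is contradicted. *)
Lemma goursat_square F x y s : 0 < s ->
  (forall a b, 0 <= a <= s -> 0 <= b <= s -> cdiff F (pt (x + a) (y + b))) ->
  square_sum_vanishes F x y s.
Proof.
move=> s0 dF e0 e0_gt0.
pose e := e0 / s ^+ 2.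
have s2 : 0 < s ^+ 2 by rewrite exprn_gt0.
have e_gt0 : 0 < e by rewrite divr_gt0.
(* The square p has lower left corner p.2 and side s / 3 ^+ p.1. *)
pose bad (p : nat * (R * R)) : Prop :=
  forall n0 : nat, exists2 n, (n0 <= n)%N & let t := s / 3 ^+ p.1 in
    ~ (nrm (square_sum F n p.2.1 p.2.2 t) <= e * t ^+ 2).
have sub p : bad p -> exists ij : 'I_3 * 'I_3,
   bad (p.1.+1, (p.2.1 + ij.1%:R * (s / 3 ^+ p.1.+1), p.2.2 + ij.2%:R * (s / 3 ^+ p.1.+1))).
  move=> bp; apply: contrapT => /forallNP nb.
  have /choice[N HN] : forall ij : 'I_3 * 'I_3, exists N : nat, forall n, (N <= n)%N ->
      let t := s / 3 ^+ p.1.+1 in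
      nrm (square_sum F n (p.2.1 + ij.1%:R * t) (p.2.2 + ij.2%:R * t) t) <= e * t ^+ 2.
    move=> ij; have /existsNP[N /forall2NP HN] := nb ij; exists N => n Nn /=.
    by have [//|/contrapT] := HN n.
  have [n /=] := bp (\sum_ij N ij).+1.
  case: n => [//|n]; rewrite ltnS => Nn; apply.
  have -> : s / 3 ^+ p.1 = 3 * (s / 3 ^+ p.1.+1).
    by rewrite exprS; field; rewrite expf_neq0// pnatr_eq0.
  set t := s / _; rewrite square_sumS.
  have -> : e * (3 * t) ^+ 2 = \sum_(i < 3) \sum_(j < 3) (e * t ^+ 2).
    by rewrite !sumr_const !card_ord; ring.
  apply: le_trans (nrm_sum _) _; apply: ler_sum => i _.
  apply: le_trans (nrm_sum _) _; apply: ler_sum => j _.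
  apply: (HN (i, j)); apply: leq_trans Nn.
  by rewrite (bigD1 (i, j))//= leq_addr.
apply: contrapT => nP.
have bad0 : bad (0%N, (x, y)).
  move=> n0; apply: contrapT => /forall2NP H; apply: nP; exists n0 => n n0n.
  have [//|/contrapT] := H n; rewrite /= expr0 divr1 /e mulfVK// lt0r_neq0//.
pose T := {p : nat * (R * R) | bad p}.
pose rel (p q : T) := exists i j : 'I_3,
  sval q = ((sval p).1.+1, ((sval p).2.1 + i%:R * (s / 3 ^+ (sval p).1.+1),
      (sval p).2.2 + j%:R * (s / 3 ^+ (sval p).1.+1))).
have next (p : T) : {q : T | rel p q}.
  case: p => p bp; have /cid[ij bq] := sub p bp.
  by exists (exist _ _ bq); exists ij.1, ij.2.
have [f [f0 fS]] := dependent_choice next (exist _ _ bad0).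
pose xs n := (sval (f n)).2.1; pose ys n := (sval (f n)).2.2.
have f1 n : (sval (f n)).1 = n.
  by elim: n => [|n IH]; [rewrite f0|have [i [j ->]] := fS n; rewrite IH].
have [|X [Y XY]] := @nested_squares xs ys s s0.
  by move=> n; have [i [j]] := fS n; exists i, j; rewrite /xs /ys p f1.
have [/andP[X0 X1] /andP[Y0 Y1]] := XY 0%N.
move: X0 X1 Y0 Y1; rewrite /xs /ys f0 /= expr0 divr1 => X0 X1 Y0 Y1.
have cXY : cdiff F (pt X Y).
  have := dF (X - x) (Y - y); rewrite !subrKC; apply; lra.
have [d d0 Hd] := square_sum_small e_gt0 cXY.
have [n nd] : exists n, 2 * (s / 3 ^+ n) < d.
  have [n Hn] : exists n : nat, 2 * s / d < n%:R.
    by exists (Num.bound (2 * s / d)); apply: archi_boundP; rewrite divr_ge0//; lra.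
  exists n; rewrite mulrA ltr_pdivrMr ?exprn_gt0//.
  move: Hn; rewrite ltr_pdivrMr// => /lt_le_trans; apply.
  by rewrite mulrC ler_pM2l// -natrX ler_nat ltnW// ltn_expl.
have := svalP (f n); rewrite /bad /= f1 => /(_ 0%N)[m _]; apply.
apply: Hd => //; first by rewrite divr_gt0// exprn_gt0.
have [/andP[Xn0 Xn1] /andP[Yn0 Yn1]] := XY n.
exists (X - xs n), (Y - ys n).
split; [lra|lra|by rewrite /xs /ys !subrKC].
Qed.

(** Near an exceptional point at which F stays bounded, the sum around a square
    of side t is at most 4 t M.  Enlarging the square by a factor 3 around
    that point adds eight squares on which F is differentiable, whose sums
    vanish in the limit; so the bound 4 t M persists up to side s, for every
    small t. *)
Lemma goursat_puncture F x y s : 0 < s ->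
  (forall z, z != pt x y -> cdiff F z) ->
  (exists M d : R, [/\ 0 < d, 0 < M & forall z, nrm (z - pt x y) < d -> nrm (F z) <= M]) ->
  square_sum_vanishes F (x - s / 2) (y - s / 2) s.
Proof.
move=> s0 dF [M [d [d0 M0 FM]]].
(* B bounds the upper limit of the sums around the concentric square of side t. *)
pose P t B := forall e, 0 < e -> exists n0 : nat, forall n, (n0 <= n)%N ->
    nrm (square_sum F n (x - t / 2) (y - t / 2) t) <= e + B.
have Psmall t : 0 < t -> t < d -> P t (4 * t * M).
  move=> t0 td e e0; exists 0%N => n _.
  apply: (@le_trans _ _ (4 * t * M)); last by lra.
  apply: square_sum_norm_le; first exact: ltW.
  move=> a b /andP[a0 a1] /andP[b0 b1]; apply: FM; apply: le_lt_trans td.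
  have -> : pt (x - t / 2 + a) (y - t / 2 + b) - pt x y = pt (a - t / 2) (b - t / 2).
    by rewrite /pt; ring.
  apply: le_trans (nrm_pt _ _) _.
  have : `|a - t / 2| <= t / 2 by rewrite ler_norml; lra.
  have : `|b - t / 2| <= t / 2 by rewrite ler_norml; lra.
  by lra.
have Pstep t B : 0 < t -> P t B -> P (3 * t) B.
  move=> t0 Pt e e0.
  have H (ij : 'I_3 * 'I_3) : exists n0 : nat, forall n, (n0 <= n)%N ->
     nrm (square_sum F n (x - 3 * t / 2 + ij.1%:R * t) (y - 3 * t / 2 + ij.2%:R * t) t)
      <= e / 9 + (if ij == (1, 1) then B else 0).
    have [->|ij1] := eqVneq ij (1, 1).
      have [|n0 Hn0] := Pt (e / 9); first by lra.
      exists n0 => n /Hn0; rewrite /=.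
      have -> : x - 3 * t / 2 + 1 * t = x - t / 2 by field.
      by have -> : y - 3 * t / 2 + 1 * t = y - t / 2 by field.
    rewrite addr0; apply: goursat_square => //; last by lra.
    move=> a b /andP[a0 a1] /andP[b0 b1]; apply: dF.
    apply: contra ij1 => /eqP/(congr1 (fun z : C => (complex.Re z, complex.Im z))).
    rewrite /pt; simpc => -[].
    case: ij => -[[|[|[|//]]] hi] -[[|[|[|//]]] hj] /= h1 h2;
      try (by exfalso; lra).
    by apply/eqP; congr pair; exact: val_inj.
  have /choice[N HN] := H.
  exists (\sum_ij N ij).+1 => -[//|n]; rewrite ltnS => Nn.
  rewrite square_sumS.
  have -> : e + B = \sum_(i < 3) \sum_(j < 3) (e / 9 + (if (i, j) == (1, 1) then B else 0)).
    by rewrite !big_ord_recr !big_ord0 /=; field.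
  apply: le_trans (nrm_sum _) _; apply: ler_sum => i _.
  apply: le_trans (nrm_sum _) _; apply: ler_sum => j _.
  apply: (HN (i, j)); apply: leq_trans Nn.
  by rewrite (bigD1 (i, j))//= leq_addr.
have Piter j t B : 0 < t -> P t B -> P (3 ^+ j * t) B.
  move=> t0 Pt; elim: j => [|j IH]; first by rewrite expr0 mul1r.
  by rewrite exprS -mulrA; apply: Pstep => //; rewrite mulr_gt0// exprn_gt0.
move=> e e0.
pose u := Num.min (d / 2) (e / (16 * M)).
have u0 : 0 < u by rewrite lt_min !divr_gt0// mulr_gt0.
have [j Hj] : exists j : nat, s / 3 ^+ j < u.
  exists (Num.bound (s / u)).
  have Hn := archi_boundP (divr_ge0 (ltW s0) (ltW u0)).
  rewrite ltr_pdivrMr ?exprn_gt0//.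
  move: Hn; rewrite ltr_pdivrMr// => /lt_le_trans; apply.
  by rewrite mulrC ler_pM2l// -natrX ler_nat ltnW// ltn_expl.
have t0 : 0 < s / 3 ^+ j by rewrite divr_gt0// exprn_gt0.
have := Psmall _ t0; move: Hj t0.
have -> : s = 3 ^+ j * (s / 3 ^+ j).
  by field; rewrite expf_neq0// pnatr_eq0.
rewrite mulrAC divff ?expf_neq0 ?pnatr_eq0// mul1r.
set t := s / _.
rewrite lt_min => /andP[td tM] t0 /(_ _)/(Piter j _ _ t0).
have {}tM : 4 * t * M < e / 2.
  by move: tM; rewrite ltr_pdivlMr ?mulr_gt0//; lra.
move=> /(_ _ (e / 2))[||n0 Hn0]; [lra|lra|].
by exists n0 => n /Hn0 /le_trans; apply; lra.
Qed.

Lemma gt0_complex (e : C) : 0 < e -> exists2 r : R, 0 < r & e = r%:C.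
Proof.
case: e => a b; rewrite ltcE /= => /andP[/eqP -> a0].
by exists a.
Qed.

Lemma derivable_cdiff F z : derivable F z 1 -> cdiff F z.
Proof.
move=> /cvg_ex[D /cvgrPdist_le HD]; exists D => e e0.
have e0C : (0 : C) < e%:C by rewrite ltcR.
have [d /= /gt0_complex[r r0 ->] Hd] := HD _ e0C.
exists r => // w wr; have [->|wz] := eqVneq w z.
  by rewrite !subrr mulr0 subr0 nrm0 mulr0.
have wz0 : w - z != 0 by rewrite subr_eq0.
have near0 : (`|0 - (w - z) : C| < r%:C :> C) by rewrite nrmE ltcR sub0r nrmN.
have : `|D - (w - z)^-1 * (F ((w - z) * 1 + z) - F z) : C| <= e%:C :> C.
  exact: Hd near0 wz0.
rewrite mulr1 subrK nrmE lecR.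
have nwz : 0 < nrm (w - z) by rewrite lt_neqAle nrm_ge0 andbT eq_sym nrm_eq0.
move=> le1; have := ler_wpM2r (ltW nwz) le1.
rewrite -nrmM -nrmN; congr (nrm _ <= _).
by rewrite mulrBl mulrAC mulVf// mul1r; ring.
Qed.

(** The quotients dz / z met along the lower side of the square of centre 0
    and half-side r, where dz is the whole side.  Multiplication by a fourth
    root of unity reduces the other sides to this one. *)
Lemma Im_quot t r : 0 < r -> `|t| <= r ->
  1 <= Im ((2 * r)%:C / (t%:C - I * r%:C)) /\ nrm ((2 * r)%:C / (t%:C - I * r%:C)) <= 2.
Proof.
move=> r0 tr.
have t2 : t ^+ 2 <= r ^+ 2.
  by move: tr; rewrite ler_norml => /andP[tl tr]; nra.
have d0 : 0 < t ^+ 2 + r ^+ 2 by rewrite ltr_wpDl ?sqr_ge0// exprn_gt0.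
have E : (2 * r)%:C / (t%:C - I * r%:C) =
   ((2 * r * t / (t ^+ 2 + r ^+ 2)) +i* (2 * r ^+ 2 / (t ^+ 2 + r ^+ 2)))%C.
  have nz : t%:C - I * r%:C != 0.
    by apply/eqP => /(congr1 Im); simpc => /= /eqP; rewrite oppr_eq0 gt_eqF.
  apply: (mulIf nz); rewrite mulfVK//; simpc; congr (_ +i* _)%C.
    by field; rewrite gt_eqF.
  by field; rewrite gt_eqF.
split.
  rewrite E /= ler_pdivlMr//; lra.
rewrite nrmM nrmR nrmV ger0_norm; last lra.
have nd : nrm (t%:C - I * r%:C) = Num.sqrt (t ^+ 2 + r ^+ 2).
  by rewrite (_ : t%:C - I * r%:C = (t +i* (- r))%C) /= ?sqrrN//; simpc.
have : r <= nrm (t%:C - I * r%:C).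
  by rewrite nd -[leLHS]ger0_norm ?(ltW r0)// -sqrtr_sqr ler_wsqrtr// lerDr sqr_ge0.
move=> rn; rewrite ler_pdivrMr; last by apply: lt_le_trans rn.
by rewrite ler_pM2l.
Qed.

Lemma Im_segment_mean_ge F n z v (u : C) c :
  (forall t, 0 <= t <= 1 -> c <= Im (u * F (z + t%:C * v))) ->
  c <= Im (u * segment_mean F n z v).
Proof.
apply: (@segment_mean_convex (fun w => c <= Im (u * w))) => [a b|a b p] ha hb => [|hp].
  have -> : u * ((a + b) / 2) = (1 / 2)%:C * (u * a + u * b) by field.
  by rewrite ImRM ImD; lra.
have -> : u * ((a + b + p) / 3) = (1 / 3)%:C * (u * a + u * b + u * p) by field.
by rewrite ImRM !ImD; lra.
Qed.

(** Each side of the square contributes at least 1 - 2 / 4 to the imaginary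
    part; for the contour integral of 1 / (z - w) the total would be 2 pi. *)
Lemma square_sum_winding F n x y r : 0 < r ->
  (forall z, r <= nrm (z - pt x y) -> nrm (F z * (z - pt x y) - 1) <= 1 / 4) ->
  2 <= Im (square_sum F n (x - r) (y - r) (2 * r)).
Proof.
move=> r0 HF.
pose q t := (2 * r)%:C / (t%:C - I * r%:C).
have key u z t : `|t| <= r -> z != pt x y ->  u / (z - pt x y) = q t -> r <= nrm (z - pt x y) ->
    1 / 2 <= Im (u * F z).
  move=> tr zn uq zr.
  have -> : u * F z = q t + q t * (F z * (z - pt x y) - 1).
    by rewrite -uq; field; rewrite subr_eq0.
  have [q1 q2] := Im_quot r0 tr; rewrite ImD.
  have := Im_nrm (q t * (F z * (z - pt x y) - 1)); rewrite nrmM ler_norml.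
  have := HF z zr; set A := nrm _ => A1.
  have : nrm (q t) * A <= 2 * (1 / 4).
    by apply: ler_pM => //; exact: nrm_ge0.
  by rewrite /q in q1 q2 *; lra.
have nzt t : t%:C - I * r%:C != 0 :> C.
  by apply/eqP => /(congr1 Im); simpc => /= /eqP; rewrite oppr_eq0 gt_eqF.
have rt t : r <= nrm (t%:C - I * r%:C).
  have := Im_nrm (t%:C - I * r%:C); rewrite (_ : Im _ = - r); last by simpc.
  by rewrite normrN ger0_norm// ltW.
have II : I * I = -1 by rewrite -expr2 sqr_i.
(* The quarter turn rho takes the lower side to the side through z. *)
have side rho z t u : nrm rho = 1 -> z - pt x y = rho * (t%:C - I * r%:C) ->
   u = rho * (2 * r)%:C -> `|t| <= r -> 1 / 2 <= Im (u * F z).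
  move=> nrho zE uE tr.
  have rho0 : rho != 0 by rewrite -nrm_eq0 nrho oner_eq0.
  apply: (key _ _ t) => //.
  - by rewrite -subr_eq0 zE mulf_neq0.
  - by rewrite uE zE /q; field; rewrite rho0 nzt.
  - by rewrite zE nrmM nrho mul1r.
have tl t : 0 <= t <= 1 -> `|2 * r * t - r| <= r.
  move=> /andP[t0 t1]; have : r * t <= r * 1 by rewrite ler_pM2l.
  by have := mulr_ge0 (ltW r0) t0; rewrite ler_norml; lra.
have tl' t : 0 <= t <= 1 -> `|r - 2 * r * t| <= r.
  by move=> /tl; rewrite distrC.
have n1 : nrm 1 = 1 by have := nrmR (1 : R); rewrite normr1.
rewrite /square_sum /segment_sum -mulNr -[X in _ + X]mulNr !ImD.
suff : [/\ 1 / 2 <= Im ((2 * r)%:C * segment_mean F n (pt (x - r) (y - r)) (2 * r)%:C),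
  1 / 2 <= Im (I * (2 * r)%:C * segment_mean F n (pt (x - r + 2 * r) (y - r)) (I * (2 * r)%:C)),
  1 / 2 <= Im (- (2 * r)%:C * segment_mean F n (pt (x - r) (y - r + 2 * r)) (2 * r)%:C) &
  1 / 2 <= Im (- (I * (2 * r)%:C) * segment_mean F n (pt (x - r) (y - r)) (I * (2 * r)%:C))].
  by case; lra.
split; apply: Im_segment_mean_ge => t ht.
- by apply: (side 1 _ (2 * r * t - r)); rewrite ?n1 ?mul1r ?tl// /pt; ring.
- apply: (side I _ (2 * r * t - r)); rewrite ?nrmi ?tl// /pt.
  transitivity (I * (2 * r * t - r)%:C - I * I * r%:C); last by ring.
  by rewrite II; ring.
- by apply: (side (-1) _ (r - 2 * r * t)); rewrite ?nrmN ?n1 ?tl'// /pt; ring.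
- apply: (side (- I) _ (r - 2 * r * t)); rewrite ?nrmN ?nrmi ?tl'// /pt.
    transitivity (- I * (r - 2 * r * t)%:C + I * I * r%:C); last by ring.
    by rewrite II; ring.
  by ring.
Qed.

Lemma near_neq z w : z != w -> \forall u \near z, u != w.
Proof.
move=> zw; apply/nbhs_ballP; exists `|z - w|; first by rewrite /= normr_gt0 subr_eq0.
by move=> u; apply: contraPneq => ->; rewrite /ball /= ltxx.
Qed.

(** The function F of the proof is -1 / h(w) times the difference quotient of h
    at w, which stays bounded near w because h is differentiable there. *)
Lemma entire_vanishing h : (forall z, derivable h z 1) ->
  (forall e, 0 < e -> exists r, forall z, r <= nrm z -> nrm (h z) <= e) ->
  forall w, h w = 0.
Proof.
move=> dh h0 w; apply: contrapT => /eqP hw.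
have wE : w = pt (complex.Re w) (complex.Im w).
  by case: w {hw} => a b; rewrite /pt; simpc.
move: wE; set x := complex.Re w; set y := complex.Im w => wE.
pose F z : C := if z == w then 0 else (1 - h z / h w) / (z - w).
have nhw : 0 < nrm (h w) by rewrite lt_neqAle nrm_ge0 andbT eq_sym nrm_eq0.
have dF z : z != pt x y -> cdiff F z.
  rewrite -wE => zw; apply: derivable_cdiff.
  have dq : derivable (fun z : C => (1 - h z * (h w)^-1) * (z - w)^-1) z 1.
    apply: derivableM.
      by apply: derivableB => //; apply: derivableM.
    by apply: derivableV; rewrite ?subr_eq0//; exact: derivableB.
  apply: near_eq_derivable dq.
  by apply: filterS (near_neq zw) => u /negbTE; rewrite /F => ->.
have bF : exists M d : R, [/\ 0 < d, 0 < M & forall z, nrm (z - pt x y) < d -> nrm (F z) <= M].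
  have [D /(_ 1 ltr01)[d d0 Hd]] := derivable_cdiff (dh w).
  have M0 : 0 <= (1 + nrm D) / nrm (h w).
    by rewrite divr_ge0// ?addr_ge0// nrm_ge0.
  exists ((1 + nrm D) / nrm (h w) + 1), d; split => //; first by lra.
  move=> z; rewrite -wE /F; case: eqVneq => [-> _|zw /Hd]; first by rewrite nrm0; lra.
  rewrite mul1r => H.
  have nzw : 0 < nrm (z - w) by rewrite lt_neqAle nrm_ge0 andbT eq_sym nrm_eq0 subr_eq0.
  apply: (@le_trans _ _ ((1 + nrm D) / nrm (h w))); last by lra.
  rewrite ler_pdivlMr// -nrmM -(ler_pM2r nzw) -nrmM.
  have -> : (1 - h z / h w) / (z - w) * h w * (z - w) = - (h z - h w - D * (z - w) + D * (z - w)).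
    have zw0 : z - w != 0 by rewrite subr_eq0.
    by field; rewrite ?hw ?zw0.
  rewrite nrmN; apply: le_trans (nrmD _ _) _; rewrite nrmM; lra.
have [|r0 Hr] := h0 (nrm (h w) / 4) _; first by lra.
have [r [rp rr]] : exists r, 0 < r /\ forall z, r <= nrm (z - w) -> r0 <= nrm z.
  exists (`|r0| + nrm w + 1); split.
    by have := nrm_ge0 w; have := normr_ge0 r0; lra.
  move=> z; have := nrmD z (- w); rewrite nrmN; have := ler_norm r0; lra.
have [n0 Hn] := @goursat_puncture F x y (2 * r) (mulr_gt0 (ltr0n _ 2) rp) dF bF 1 ltr01.
have := Hn n0 (leqnn _).
have -> : 2 * r / 2 = r by field.
have : 2 <= Im (square_sum F n0 (x - r) (y - r) (2 * r)).
  apply: square_sum_winding => // z; rewrite -wE => zr.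
  have zw : z != w.
    by apply: contraTneq zr => ->; rewrite subrr nrm0 -ltNge.
  rewrite /F (negbTE zw) mulfVK ?subr_eq0//.
  rewrite addrAC subrr sub0r nrmN nrmM nrmV ler_pdivrMr//.
  by apply: le_trans (Hr z (rr z zr)) _; lra.
by have := Im_nrm (square_sum F n0 (x - r) (y - r) (2 * r)); rewrite ler_norml; lra.
Qed.

Lemma derivable_continuous (f : C -> C) : (forall z, derivable f z 1) -> continuous f.
Proof. by move=> df z; apply: differentiable_continuous; apply/derivable1_diffP. Qed.

Lemma continuous_eq0 (u : C -> C) :
  continuous u -> (forall l, l != 0 -> u l = 0) -> forall l, u l = 0.
Proof.
move=> cu u0 l; have [->|/u0//] := eqVneq l 0.
have c1 : (u x @[x --> 0^'] --> u 0)%classic by apply: cvg_within_filter; exact: cu.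
have c2 : (u x @[x --> 0^'] --> (0 : C))%classic.
  apply: (@cvg_trans _ ((cst 0 : C -> C) x @[x --> 0^'])%classic); last exact: cvg_cst.
  apply: near_eq_cvg; near=> x; rewrite u0//.
  by near: x; exact: nbhs_dnbhs_neq.
exact: cvg_unique c1 c2.
Unshelve. all: by end_near. Qed.

(** The functions u and v glue to a section over the Riemann sphere of a line
    bundle of negative degree -n.  Here l^n u(l) - v(0) is entire and tends
    to 0 at infinity, hence is 0, and its value at l = 0 is -v(0). *)
Lemma liouville_at_infinity (u v : C -> C) n : (0 < n)%N ->
  (forall z, derivable u z 1) -> (forall z, derivable v z 1) ->
  (forall l, l != 0 -> l ^+ n * u l = v l^-1) ->
  (forall l, u l = 0) /\ (forall l, v l = 0).
Proof.
move=> n0 du dv uv.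
pose h l := l ^+ n * u l - v 0.
have h0 : forall l, h l = 0.
  apply: entire_vanishing => [z|e e0].
    apply: derivableB => //; apply: derivableM => //.
    exact: exprn_derivable.
  have [D /(_ 1 ltr01)[d d0 Hd]] := derivable_cdiff (dv 0).
  have D0 : 0 < 1 + nrm D by have := nrm_ge0 D; lra.
  pose r := d^-1 + (1 + nrm D) / e.
  have p1 : 0 < d^-1 by rewrite invr_gt0.
  have p2 : 0 < (1 + nrm D) / e by rewrite divr_gt0.
  exists r => z rz.
  have nz : 0 < nrm z by rewrite /r in rz; lra.
  have z0 : z != 0 by rewrite -nrm_eq0 gt_eqF.
  rewrite /h uv//.
  have z1 : (nrm z)^-1 < d.
    rewrite invf_plt ?posrE//; apply: lt_le_trans rz.
    by rewrite /r; lra.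
  have := Hd z^-1; rewrite subr0 nrmV mul1r => /(_ z1) Hv.
  have -> : v z^-1 - v 0 = (v z^-1 - v 0 - D * z^-1) + D * z^-1 by ring.
  apply: le_trans (nrmD _ _) _; rewrite nrmM nrmV.
  have : (1 + nrm D) / nrm z <= e.
    by rewrite ler_pdivrMr// mulrC -ler_pdivrMr//; rewrite /r in rz; lra.
  by rewrite mulrDl mul1r; lra.
have v0 : v 0 = 0.
  by have := h0 0; rewrite /h expr0n gtn_eqF//= mul0r sub0r => /eqP; rewrite oppr_eq0 => /eqP.
have u0 : forall l, u l = 0.
  apply: continuous_eq0; first exact: derivable_continuous.
  move=> l l0; have := h0 l; rewrite /h v0 subr0 => /eqP.
  by rewrite mulf_eq0 expf_eq0 (negbTE l0) andbF => /eqP.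
split=> // l; have [->//|l0] := eqVneq l 0.
by have := uv l^-1; rewrite invrK invr_eq0 u0 mulr0 => /(_ l0) <-.
Qed.

End Liouville.

(** * Matrix-valued functions *)

Section Entries.
Variables (K : numFieldType) (V : normedModType K).

(** A matrix is the sum of its entries times constant matrices. *)
Lemma differentiable_entries m n (f : V -> 'M[K]_(m, n)) z :
  (forall i j, differentiable (fun v => f v i j : K) z) -> differentiable f z.
Proof.
move=> df.
have -> : f = \sum_(i < m) \sum_(j < n) (fun v => (f v i j : K) *: delta_mx i j).
  apply/funext => v; rewrite fct_sumE [LHS]matrix_sum_delta.
  by apply: eq_bigr => i _; rewrite fct_sumE.
apply: differentiable_sum => i; apply: differentiable_sum => j.
exact: differentiableZl.
Qed.

Lemma differentiable_entry m n (f : V -> 'M[K]_(m, n)) z i j :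
  differentiable f z -> differentiable (fun v => f v i j : K) z.
Proof.
move=> df.
apply: (@differentiable_comp _ _ _ _ f (fun N : 'M[K]_(m, n) => N i j : K)) => //.
exact: differentiable_coord.
Qed.

Lemma derive_entry m n (f : V -> 'M[K]_(m, n)) z v i j :
  differentiable f z -> ('D_v f z) i j = 'D_v (fun w => f w i j : K) z.
Proof.
move=> df; rewrite !deriveE//; last exact: differentiable_entry.
pose c (N : 'M[K]_(m, n)) : K := N i j.
have lin_c : linear c by move=> t M N; rewrite /c !mxE.
pose cL : {linear 'M[K]_(m, n) -> K} :=
  HB.pack c (GRing.isLinear.Build _ _ _ _ _ lin_c).
have dc : 'd c (f z) = c :> ('M[K]_(m, n) -> K).
  by apply: (@diff_lin _ _ _ cL); exact: coord_continuous.
by rewrite (@diff_comp _ _ _ _ f c)//= ?dc//; exact: differentiable_coord.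
Qed.

Lemma derive_line (f : V -> K) z v :
  'D_v f z = 'D_1 (fun h : K => f (h *: v + z)) 0.
Proof.
rewrite /derive; set g1 := fun h => h^-1 *: _; set g2 := fun h => h^-1 *: _.
suff -> : g1 = g2 by [].
by rewrite funeqE /g1 /g2 => h /=; rewrite addr0 scale0r add0r [_%:A]mulr1.
Qed.

Lemma is_derive_horner (p : {poly K}) (x : K) :
  is_derive x (1 : K) (horner p) p^`().[x].
Proof.
elim/poly_ind: p => [|p c IH].
  have -> : horner (0 : {poly K}) = cst 0 by apply/funext => y; rewrite horner0.
  by rewrite deriv0 horner0; exact: is_derive_cst.
have -> : horner (p * 'X + c%:P) = (horner p * id + cst c)%R.
  by apply/funext => y; rewrite hornerMXaddC.
apply: is_derive_eq.
by rewrite addr0 derivD derivC addr0 derivM derivX mulr1 !hornerE [_%:A]mulr1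
   /= /GRing.scale /= addrC [x * _]mulrC.
Qed.

Lemma derive_reparam (f : K -> K) (g : K -> V) x :
  differentiable f x -> differentiable g (f x) ->
  'D_1 (g \o f) x = 'D_1 f x *: 'D_1 g (f x).
Proof.
move=> df dg.
rewrite !deriveE//; last exact: differentiable_comp.
by rewrite diff_comp//= -linearZ [_ *: 1]mulr1.
Qed.

End Entries.

Lemma mul_scalar_block (K : pzRingType) (p q r s p' q' r' s' : K) :
  block_mx p%:M q%:M r%:M s%:M *m block_mx p'%:M q'%:M r'%:M s'%:M =
  block_mx (p * p' + q * r')%:M (p * q' + q * s')%:M
           (r * p' + s * r')%:M (r * q' + s * s')%:M :> 'M[K]_(1 + 1).
Proof. by rewrite mulmx_block -!scalar_mxM -!raddfD. Qed.

(** * The twistor space and the normal bundle *)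

Section Twistor.
Variables (R : realType) (k : nat) (a : Cplx R).
Hypothesis hk : (3 <= k)%N.
Local Notation C := (Cplx R).
Local Notation F := (twistor_patching k a).
Local Notation "P ^[ l ]" := (map_mx (horner_eval l) P)
  (at level 2, format "P ^[ l ]").

Lemma holomorphic_polymx m n (P : 'M[{poly C}]_(m, n)) :
  holomorphic (fun l : C => map_mx (horner_eval l) P).
Proof.
move=> l; apply: differentiable_entries => i j.
have -> : (fun v : C => map_mx (horner_eval v) P i j) = horner (P i j).
  by apply/funext => v; rewrite mxE.
by apply/derivable1_diffP; have [] := is_derive_horner (P i j) l.
Qed.

Lemma derive1_polymx m n (P : 'M[{poly C}]_(m, n)) :
  (fun l : C => map_mx (horner_eval l) P)^`()%classic =
  (fun l : C => map_mx (horner_eval l) (map_mx (@deriv C) P)).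
Proof.
apply/funext => l; rewrite derive1E; apply/matrixP => i j.
rewrite derive_entry; last exact: holomorphic_polymx.
rewrite !mxE; have [_ dP] := is_derive_horner (P i j) l.
apply: etrans dP.
by congr ('D_1 _ l); apply/funext => v; rewrite mxE.
Qed.

Lemma exp_km2 (l : C) : l ^ (k%:Z - 2) = l ^+ (k - 2).
Proof. by rewrite subzn// ltnW. Qed.

Lemma patching_differentiable (p : 'rV[C]_3) : p 0 0 != 0 -> differentiable F p.
Proof.
move=> p0; apply: differentiable_entries => i j.
rewrite ord1.
have d0 j' : differentiable (fun z : 'rV[C]_3 => z 0 j' : C) p by exact: differentiable_coord.
have dX j' n : differentiable (fun z : 'rV[C]_3 => z 0 j' ^+ n : C) p.
  case: n => [|n]; first exact: differentiable_cst.
  have -> : (fun z : 'rV[C]_3 => z 0 j' ^+ n.+1 : C) = (fun z : 'rV[C]_3 => z 0 j' : C) ^+ n.+1.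
    by apply/funext => z; rewrite exprfctE.
  exact: differentiableX.
have dV n : differentiable (fun z : 'rV[C]_3 => (z 0 0 ^+ n)^-1 : C) p.
  by apply: differentiableV; [exact: dX|rewrite expf_neq0].
case: j => [[|[|[|//]]] hj].
- have -> : (fun v => F v 0 (Ordinal hj)) = (fun z : 'rV[C]_3 => (z 0 0 ^+ 1)^-1).
    by apply/funext => z; rewrite !mxE expr1.
  exact: dV.
- have -> : (fun v => F v 0 (Ordinal hj)) = (fun z : 'rV[C]_3 => (z 0 0 ^+ k)^-1 * z 0 1).
    by apply/funext => z; rewrite !mxE /= -exprnN.
  exact: differentiableM.
- have -> : (fun v => F v 0 (Ordinal hj)) = (fun z : 'rV[C]_3 =>
      z 0 0 ^+ (k - 2) * z 0 2 + a * (z 0 0 ^+ 2)^-1 * z 0 1 ^+ 2).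
    by apply/funext => z; rewrite !mxE /= exp_km2 -exprnN.
  apply: differentiableD; first by apply: differentiableM => //; exact: dX.
  apply: differentiableM; last exact: dX.
  by apply: differentiableM.
Qed.

(** Rows are indexed by dQ, dtau and columns by their counterparts in the other
    chart. *)
Definition fibre_jacobian (l Q : C) : 'M[C]_(1 + 1) :=
  block_mx (l ^ (- k%:Z))%:M (2 * a * l ^ (- 2%:Z) * Q)%:M
           0%:M (l ^ (k%:Z - 2))%:M.

(** In a vertical direction v the patching map is polynomial along the line
    p + h v. *)
Lemma derive_patching_fibre (p v : 'rV[C]_3) (j : 'I_3) : v 0 0 = 0 ->
  'D_v (fun z => F z 0 j : C) p =
    [:: 0; p 0 0 ^ (- k%:Z) * v 0 1;
        p 0 0 ^ (k%:Z - 2) * v 0 2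
        + 2 * a * p 0 0 ^ (- 2%:Z) * p 0 1 * v 0 1]`_j.
Proof.
move=> v0; rewrite derive_line.
have lin1 (P : {poly C}) f : f =1 horner P -> 'D_1 f 0 = P^`().[0].
  move=> /funext ->; have [_ dP] := is_derive_horner P 0; exact: dP.
pose P := [:: ((p 0 0)^-1)%:P; p 0 0 ^ (- k%:Z) *: (v 0 1 *: 'X + (p 0 1)%:P);
  p 0 0 ^ (k%:Z - 2) *: (v 0 2 *: 'X + (p 0 2)%:P) +
  (a * p 0 0 ^ (- 2%:Z)) *: (v 0 1 *: 'X + (p 0 1)%:P) ^+ 2]`_j.
rewrite (lin1 P); last first.
  move=> h; rewrite !mxE v0 mulr0 add0r.
  case: j @P => [[|[|[|//]]] hj] P; rewrite /P /= ?hornerC ?hornerD ?hornerZ ?hornerXn ?hornerE ?(mulrC h)//.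
rewrite {}/P.
have D (al be : C) : (al *: 'X + be%:P)^`() = al%:P.
  by rewrite derivD derivZ derivX derivC addr0 alg_polyC.
case: j => [[|[|[|//]]] hj] /=.
- by rewrite derivC horner0.
- by rewrite derivZ D !hornerE.
- by rewrite derivD !derivZ deriv_exp !D !hornerE; rewrite ?expr1; ring.
Qed.

Lemma jacobian_fibre (p : 'rV[C]_3) : p 0 0 != 0 ->
  dsubmx ('J F p : 'M[C]_(1 + (1 + 1), 1 + (1 + 1)))
  = row_mx 0 (fibre_jacobian (p 0 0) (p 0 1)).
Proof.
move=> p0; have dF := patching_differentiable p0.
have JE (i j : 'I_3) : i != 0 -> 'J F p i j =
   [:: 0; p 0 0 ^ (- k%:Z) * (i == 1)%:R;
        p 0 0 ^ (k%:Z - 2) * (i == 2)%:R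
        + 2 * a * p 0 0 ^ (- 2%:Z) * p 0 1 * (i == 1)%:R]`_j.
  move=> i0; have -> : 'J F p i j = 'D_(delta_mx 0 i) (fun z => F z 0 j : C) p.
    by rewrite -derive_entry// deriveEjacobian// -rowE [RHS]mxE.
  by rewrite derive_patching_fibre !mxE !eqxx /= ![_ == i]eq_sym ?(negbTE i0).
apply/matrixP => i j; rewrite mxE JE// /fibre_jacobian.
have [{}j ->|{}j ->] := @split_ordP 1 (1 + 1) j.
  by rewrite row_mxEl mxE ord1.
rewrite row_mxEr.
have [{}j ->|{}j ->] := @split_ordP 1 1 j;
  have [{}i ->|{}i ->] := @split_ordP 1 1 i; rewrite !ord1.
- by rewrite block_mxEul !mxE /= mulr1.
- by rewrite block_mxEdl !mxE /= mulr0.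
- by rewrite block_mxEur !mxE /= mulr0 mulr1 add0r.
- by rewrite block_mxEdr !mxE /= mulr0 mulr1 addr0.
Qed.

(** The chain rule for F (s l) = s_inf (1 / l): the Jacobian identifies the
    tangent lines of the section in the two charts. *)
Lemma section_velocity (s : hol_section F) (l : C) : l != 0 ->
  (sec s)^`()%classic l *m 'J F (sec s l) =
  - l ^- 2 *: (sec_inf s)^`()%classic l^-1.
Proof.
move=> l0.
have dF : differentiable F (sec s l) by apply: patching_differentiable; rewrite ?sec_proj.
have dS := sec_holo s l.
have dI : differentiable (sec_inf s) l^-1 by exact: sec_inf_holo.
have dV : differentiable (fun z : C => z^-1 : C) l by exact: differentiable_Rinv.
have patch : \near l, (F \o sec s) l = (sec_inf s \o (fun z : C => z^-1 : C)) l.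
  by apply: filterS (near_neq l0) => z z0; rewrite /= sec_patch.
have e1 : 'D_1 (F \o sec s) l = 'd F (sec s l) ('D_1 (sec s) l).
  rewrite deriveE; last exact: differentiable_comp.
  by rewrite (diff_comp dS dF) (deriveE _ dS).
rewrite !derive1E -deriveEjacobian// (deriveE _ dF) -e1 (near_eq_derive _ patch).
rewrite (derive_reparam dV dI); congr (_ *: _).
have -> := @deriveV C C id l 1 l0 (@derivable_id _ _ l 1).
by rewrite derive_id [_ *: _]mulr1.
Qed.

Definition curve (x t : {poly C}) : 'rV[{poly C}]_(1 + (1 + 1)) :=
  row_mx 'X%:M (row_mx x%:M t%:M).

(** The projection of the tangent space of the three-fold to its vertical part
    along the velocity (1, x', t') of the curve, followed by A. *)
Definition normal_frame (x t : {poly C}) (A : 'M[{poly C}]_(1 + 1)) :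
    'M[{poly C}]_(1 + (1 + 1), 1 + 1) :=
  col_mx (- row_mx x^`()%:M t^`()%:M *m A) A.

Lemma curveE x t l (j : 'I_3) : (curve x t)^[l] 0 j = [:: l; x.[l]; t.[l]]`_j.
Proof.
rewrite mxE /curve.
have [{}j ->|{}j ->] := @split_ordP 1 (1 + 1) j.
  by rewrite row_mxEl mxE ord1 /= /horner_eval mulr1n hornerX.
rewrite row_mxEr; have [{}j ->|{}j ->] := @split_ordP 1 1 j.
  by rewrite row_mxEl mxE ord1 /= /horner_eval mulr1n.
by rewrite row_mxEr mxE ord1 /= /horner_eval mulr1n.
Qed.

Lemma curve_deriv x t l :
  (map_mx (@deriv C) (curve x t))^[l] = row_mx 1%:M (row_mx x^`()%:M t^`()%:M)^[l].
Proof.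
have dM (p : {poly C}) : map_mx (@deriv C) (p%:M : 'M[{poly C}]_1) = (p^`())%:M.
  by apply/matrixP => i j; rewrite !mxE !ord1 !mulr1n.
by rewrite /curve !map_row_mx !dM derivX map_scalar_mx /= /horner_eval hornerC.
Qed.

Lemma normal_frame_eval x t A l :
  (normal_frame x t A)^[l] = col_mx (- (row_mx x^`()%:M t^`()%:M)^[l] *m A^[l]) A^[l].
Proof. by rewrite map_col_mx map_mxM map_mxN. Qed.

Lemma normal_frame_kernel x t A l : A^[l] \in unitmx ->
  row_full (normal_frame x t A)^[l] /\
  (kermx (normal_frame x t A)^[l] == (map_mx (@deriv C) (curve x t))^[l])%MS.
Proof.
move=> uA; rewrite normal_frame_eval curve_deriv.
set v := (row_mx _ _)^[l]; set P := col_mx _ _.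
have rP : \rank P = 2%N.
  apply/eqP; rewrite eqn_leq rank_leq_col /=.
  apply: (@leq_trans (\rank A^[l])); first by rewrite mxrank_unit.
  apply: mxrankS; apply/submxP; exists (row_mx 0 1%:M).
  by rewrite mul_row_col mul0mx add0r mul1mx.
split; first by rewrite /row_full rP.
rewrite andbC -[X in is_true X]/(row_mx 1%:M v == kermx P)%MS.
have sub : (row_mx 1%:M v <= kermx P)%MS.
  by apply/sub_kermxP; rewrite mul_row_col mul1mx mulNmx addNr.
have := mxrank_leqif_eq sub => -[_ <-].
rewrite mxrank_ker rP eqn_leq rank_leq_row /=.
rewrite lt0n mxrank_eq0; apply/eqP => /(congr1 lsubmx).
rewrite row_mxKl lsubmx_const => /matrixP/(_ 0 0); rewrite !mxE /= => /eqP.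
by rewrite oner_eq0.
Qed.

(** Only the lower two rows of the intertwining relation are checked; the first
    follows, because the Jacobian maps velocities to velocities, which both
    projections annihilate, and a velocity has first coordinate 1. *)
Lemma normal_bundle_of_frames (s : hol_section F) (x t x' t' : {poly C})
    (A B : 'M[{poly C}]_(1 + 1)) (g : bundle R (1 + 1)) :
  (forall l, sec s l = (curve x t)^[l]) ->
  (forall l, sec_inf s l = (curve x' t')^[l]) ->
  (forall l, A^[l] \in unitmx) -> (forall l, B^[l] \in unitmx) ->
  (forall l, l != 0 -> fibre_jacobian l x.[l] *m B^[l^-1] = A^[l] *m g l) ->
  has_normal_bundle s g.
Proof.
move=> secE sec_infE uA uB AB.
have dsec l : (sec s)^`()%classic l = (map_mx (@deriv C) (curve x t))^[l].
  by have /funext -> := secE; rewrite derive1_polymx.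
have dsec_inf l : (sec_inf s)^`()%classic l = (map_mx (@deriv C) (curve x' t'))^[l].
  by have /funext -> := sec_infE; rewrite derive1_polymx.
exists (fun l => (normal_frame x t A)^[l]), (fun l => (normal_frame x' t' B)^[l]).
split.
- by split; exact: holomorphic_polymx.
- move=> l l0.
  have s0 : sec s l 0 0 = l by rewrite sec_proj.
  have s1 : sec s l 0 1 = x.[l] by rewrite secE curveE.
  set J : 'M[C]_(1 + (1 + 1)) := 'J F (sec s l).
  (* The defect of the intertwining relation. *)
  pose X := J *m (normal_frame x' t' B)^[l^-1] - (normal_frame x t A)^[l] *m g l.
  apply/subr0_eq; rewrite -[LHS]/X -[X]vsubmxK.
  have dX : dsubmx X = 0.
    have -> : dsubmx X = dsubmx J *m (normal_frame x' t' B)^[l^-1] - A^[l] *m g l.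
      rewrite /X linearB /= -[in J *m _](vsubmxK J) mul_col_mx col_mxKd.
      by rewrite [in (normal_frame x t A)^[_]]normal_frame_eval mul_col_mx col_mxKd.
    rewrite jacobian_fibre ?s0// s1 normal_frame_eval mul_row_col mul0mx add0r.
    by rewrite AB// subrr.
  have vX : (map_mx (@deriv C) (curve x t))^[l] *m X = 0.
    rewrite mulmxBr !mulmxA -dsec section_velocity// dsec dsec_inf.
    have [_ /andP[_ /sub_kermxP K1]] := normal_frame_kernel x t (uA l).
    have [_ /andP[_ /sub_kermxP K2]] := normal_frame_kernel x' t' (uB l^-1).
    by rewrite -scalemxAl K1 K2 scaler0 mul0mx subrr.
  have uX : usubmx X = 0.
    move: vX; rewrite -[X in _ *m X]vsubmxK dX curve_deriv.
    by rewrite mul_row_col mulmx0 addr0 mul1mx.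
  by rewrite uX dX col_mx0.
- by move=> l; rewrite dsec; exact: normal_frame_kernel.
- by move=> l; rewrite dsec_inf; exact: normal_frame_kernel.
Qed.

(** * Sections are determined by their Q-coordinate *)

(** The patching relations for a pair of polynomial curves. *)
Definition matched (x t x' t' : {poly C}) := forall l : C, l != 0 ->
  l ^ (- k%:Z) * x.[l] = x'.[l^-1] /\
  l ^ (k%:Z - 2) * t.[l] + a * l ^ (- 2%:Z) * x.[l] ^+ 2 = t'.[l^-1].

Lemma matched_patch x t x' t' l : matched x t x' t' -> l != 0 ->
  F (curve x t)^[l] = (curve x' t')^[l^-1].
Proof.
move=> H l0; have [H1 H2] := H l l0; apply/rowP => j.
rewrite curveE mxE !curveE /= H1 H2.
by case: j => [[|[|[|//]]] hj].
Qed.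

(** Transparent, so that its Q-coordinate can be read off. *)
Definition poly_section x t x' t' (H : matched x t x' t') : hol_section F.
Proof.
refine (@Build_hol_section R F (fun l => (curve x t)^[l]) (fun l => (curve x' t')^[l])
  (holomorphic_polymx _) (holomorphic_polymx _) _ _ _).
- by move=> l; rewrite curveE.
- by move=> l; rewrite curveE.
- by move=> l l0; exact: matched_patch.
Defined.

Lemma section_entry_derivable (f : C -> 'rV[C]_3) j : holomorphic f ->
  forall z, derivable (fun l => f l 0 j : C) z 1.
Proof. by move=> hf z; apply/derivable1_diffP/differentiable_entry. Qed.

Lemma horner_derivable (p : {poly C}) z : derivable (fun l : C => p.[l]) z 1.
Proof. by have [] := is_derive_horner p z. Qed.

(** Two lifts of Q differ in tau by functions u and v with
    l^(k-2) u(l) = v(1 / l), which vanish since k > 2. *)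
Lemma section_unique (s : hol_section F) x t x' t' :
  matched x t x' t' -> (forall l, sec s l 0 1 = x.[l]) ->
  (forall l, sec s l = (curve x t)^[l]) /\ (forall l, sec_inf s l = (curve x' t')^[l]).
Proof.
move=> H sx.
have patch l : l != 0 -> sec_inf s l^-1 0 1 = x'.[l^-1] /\
    l ^+ (k - 2) * (sec s l 0 2 - t.[l]) = sec_inf s l^-1 0 2 - t'.[l^-1].
  move=> l0; have [H1 H2] := H l l0; rewrite -sec_patch// !mxE /= sec_proj sx.
  by split=> //; rewrite -H2 !exp_km2; ring.
have ds j z : derivable (fun l => sec s l 0 j : C) z 1.
  by apply: section_entry_derivable; exact: sec_holo.
have di j z : derivable (fun l => sec_inf s l 0 j : C) z 1.
  by apply: section_entry_derivable; exact: sec_inf_holo.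
have [||||u0 v0] := @liouville_at_infinity R (fun l => sec s l 0 2 - t.[l])
    (fun l => sec_inf s l 0 2 - t'.[l]) (k - 2).
- by rewrite subn_gt0.
- by move=> z; apply: derivableB; [exact: ds|exact: horner_derivable].
- by move=> z; apply: derivableB; [exact: di|exact: horner_derivable].
- by move=> l l0; have [_ ->] := patch l l0.
have x0 : forall l, sec_inf s l 0 1 - x'.[l] = 0.
  apply: continuous_eq0.
    by apply: derivable_continuous => z; apply: derivableB; [exact: di|exact: horner_derivable].
  move=> l l0; have [|] := patch l^-1; first by rewrite invr_eq0.
  by rewrite invrK => -> _; rewrite subrr.
split=> l; apply/rowP => j; rewrite curveE.
- case: j => [[|[|[|//]]] hj] /=.
  + by rewrite -[RHS](sec_proj s l); congr (sec s l _ _); apply: val_inj.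
  + by rewrite -sx; congr (sec s l _ _); apply: val_inj.
  + rewrite -(subr0_eq (u0 l)); congr (sec s l _ _); exact: val_inj.
- case: j => [[|[|[|//]]] hj] /=.
  + by rewrite -[RHS](sec_inf_proj s l); congr (sec_inf s l _ _); apply: val_inj.
  + by rewrite -(subr0_eq (x0 l)); congr (sec_inf s l _ _); apply: val_inj.
  + rewrite -(subr0_eq (v0 l)); congr (sec_inf s l _ _); exact: val_inj.
Qed.

(** * Explicit frames of the normal bundle *)

Section Frames.
Variables (e d : C) (i : nat).
Hypotheses (a0 : a != 0) (e0 : e != 0) (ik : (i <= k)%N).
Let c := 2 * a * e.

(** The inverse of the row operations and the column operations, the latter in
    the variable 1 / l, that diagonalize the fibre Jacobian.  Both matrices
    have determinant 1. *)
Definition frame_zero : 'M[{poly C}]_(1 + 1) :=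
  block_mx (1 + (d / e) *: 'X^(k - i))%:M (2 * a * d)%:P%:M
           (c^-1 *: 'X^(k - i))%:M 1%:M.
Definition frame_inf : 'M[{poly C}]_(1 + 1) :=
  block_mx 0%:M (- c)%:P%:M (c^-1)%:P%:M 'X^(k + i - 2)%:M.

Lemma eval_block (p q r s : {poly C}) l :
  (block_mx p%:M q%:M r%:M s%:M : 'M[{poly C}]_(1 + 1))^[l] =
  block_mx p.[l]%:M q.[l]%:M r.[l]%:M s.[l]%:M.
Proof. by rewrite map_block_mx !map_scalar_mx. Qed.

Lemma unit_block (p q r s : C) : p * s - q * r = 1 ->
  (block_mx p%:M q%:M r%:M s%:M : 'M[C]_(1 + 1)) \in unitmx.
Proof.
move=> D; suff /mulmx1_unit[] : (block_mx p%:M q%:M r%:M s%:M : 'M[C]_(1 + 1)) *m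
   block_mx s%:M (- q)%:M (- r)%:M p%:M = 1%:M by [].
rewrite mul_scalar_block [RHS]scalar_mx_block.
rewrite -(raddf0 (@scalar_mx C 1)).
by congr (block_mx _%:M _%:M _%:M _%:M); rewrite -?D; ring.
Qed.

Lemma frame_zero_unit l : frame_zero^[l] \in unitmx.
Proof.
rewrite eval_block; apply: unit_block; rewrite !hornerE /c /=.
by field; rewrite a0 e0.
Qed.

Lemma frame_inf_unit l : frame_inf^[l] \in unitmx.
Proof.
rewrite eval_block; apply: unit_block; rewrite !hornerE /c /=.
by field; rewrite a0 e0.
Qed.

Lemma frames_match l : l != 0 ->
  fibre_jacobian l (e *: 'X^i + d *: 'X^k).[l] *m frame_inf^[l^-1] =
  frame_zero^[l] *m bundle_sum (line_bundle (2 - i%:Z)) (line_bundle i%:Z) l.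
Proof.
move=> l0; have -> : bundle_sum (line_bundle (2 - i%:Z)) (line_bundle i%:Z) l =
    block_mx (l ^ (- (2 - i%:Z)))%:M 0%:M 0%:M (l ^ (- i%:Z))%:M.
  by rewrite raddf0.
rewrite !eval_block !mul_scalar_block.
have P0 n : l ^+ n != 0 by rewrite expf_neq0.
have E1 : l ^+ (k - i) = l ^+ k / l ^+ i by rewrite -[in RHS](subnK ik) exprD mulfK.
have E2 : l ^- (k + i - 2) = l ^+ 2 / (l ^+ k * l ^+ i).
  rewrite -exprD -[in RHS](@subnK 2 (k + i)); last by lia.
  by rewrite [in RHS]exprD; field; rewrite ?P0 ?l0.
have E3 : l ^ (k%:Z - 2) = l ^+ k / l ^+ 2.
  by rewrite exp_km2// -[in RHS](@subnK 2 k) ?exprD ?mulfK// ltnW.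
have E4 : l ^ (- (2 - i%:Z)) = l ^+ i / l ^+ 2.
  by rewrite opprB expfzDr// -exprnN.
rewrite !hornerE exprVn E1 E2 E3 E4 -!exprnN /c /=.
by congr (block_mx _%:M _%:M _%:M _%:M); field; rewrite ?a0 ?e0 ?l0 ?P0.
Qed.

Lemma normal_bundle_binomial (s : hol_section F) t x' t' :
  matched (e *: 'X^i + d *: 'X^k) t x' t' ->
  (forall l, sec s l 0 1 = (e *: 'X^i + d *: 'X^k).[l]) ->
  has_normal_bundle s (bundle_sum (line_bundle (2 - i%:Z)) (line_bundle i%:Z)).
Proof.
move=> H sx; have [h1 h2] := section_unique H sx.
exact: normal_bundle_of_frames h1 h2 frame_zero_unit frame_inf_unit frames_match.
Qed.

End Frames.

(** * Binomial sections *)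

(** The terms of a l^-2 x^2 other than a e^2 l^(2i-2) are multiples of l^(k-2)
    and are absorbed by tau; lo and hi are the contributions of that one term
    to tau in the two charts. *)
Lemma binomial_matched (e d : C) i (lo hi : {poly C}) : (i <= k)%N ->
  (forall l : C, l != 0 ->
     l ^+ (k - 2) * lo.[l] + hi.[l^-1] = a * e ^+ 2 * (l ^+ i) ^+ 2 / l ^+ 2) ->
  matched (e *: 'X^i + d *: 'X^k)
    (- (lo + (2 * a * e * d) *: 'X^i + (a * d ^+ 2) *: 'X^k))
    (e *: 'X^(k - i) + d%:P) hi.
Proof.
move=> ik lohi l l0.
have P0 n : l ^+ n != 0 by rewrite expf_neq0.
have E1 : l ^+ (k - i) = l ^+ k / l ^+ i by rewrite -[in RHS](subnK ik) exprD mulfK.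
have E3 : l ^+ (k - 2) = l ^+ k / l ^+ 2.
  by rewrite -[in RHS](@subnK 2 k) ?exprD ?mulfK// ltnW.
have -> : hi.[l^-1] = a * e ^+ 2 * (l ^+ i) ^+ 2 / l ^+ 2 - l ^+ (k - 2) * lo.[l].
  by rewrite -lohi//; ring.
rewrite exp_km2// !hornerE /= exprVn E1 E3 -!exprnN.
by split; field; rewrite ?P0 ?l0.
Qed.

Lemma binomial_sections (e d : C) i (lo hi : {poly C}) :
  a != 0 -> e != 0 -> (i <= k)%N ->
  (forall l : C, l != 0 ->
     l ^+ (k - 2) * lo.[l] + hi.[l^-1] = a * e ^+ 2 * (l ^+ i) ^+ 2 / l ^+ 2) ->
  let x := e *: 'X^i + d *: 'X^k in
  (exists s : hol_section F, section_coefs s x) /\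
  (forall s : hol_section F, section_coefs s x ->
     has_normal_bundle s
       (bundle_sum (line_bundle (2 - i%:Z)) (line_bundle i%:Z))).
Proof.
move=> a0 e0 ik lohi x.
have H := binomial_matched d ik lohi.
have sx : (size x <= k.+1)%N.
  apply: leq_trans (size_polyD _ _) _; rewrite geq_max.
  by rewrite !(leq_trans (size_scale_leq _ _))// size_polyXn.
split.
  by exists (poly_section H); split=> // l; rewrite curveE.
by move=> s [_ sE]; exact: (normal_bundle_binomial a0 e0 ik H sE).
Qed.

(** The constant matrix W exchanges the two summands. *)
Lemma normal_bundle_swap (s : hol_section F) (g h : bundle R 1) :
  has_normal_bundle s (bundle_sum g h) -> has_normal_bundle s (bundle_sum h g).
Proof.
move=> [p [q [[hp hq] pq P Q]]].
pose W : 'M[C]_(1 + 1) := block_mx 0 1%:M 1%:M 0.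
have WW : W *m W = 1%:M.
  rewrite mulmx_block !mul0mx !mulmx0 !mul1mx !addr0 !add0r.
  by rewrite [RHS]scalar_mx_block.
have uW : W \in unitmx by have [] := mulmx1_unit WW.
have hW (f : C -> 'M[C]_(3, 1 + 1)) : holomorphic f -> holomorphic (fun l => f l *m W).
  move=> hf l; apply: differentiable_entries => i j.
  have -> : (fun v => (f v *m W) i j) = \sum_m (fun v => W m j *: (f v i m : C)).
    by apply/funext => v; rewrite mxE fct_sumE; apply: eq_bigr => m _; rewrite mulrC.
  apply: differentiable_sum => m; apply: differentiableZ.
  by apply: differentiable_entry; exact: hf.
have K (M : 'M[C]_(3, 1 + 1)) (v : 'rV[C]_3) :
    row_full M /\ (kermx M == v)%MS -> row_full (M *m W) /\ (kermx (M *m W) == v)%MS.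
  move=> [fM kM]; split; first by rewrite /row_full mxrankMfree// row_free_unit.
  have /andP[k1 k2] := kM; apply/andP; split.
    apply: submx_trans k1; apply/sub_kermxP.
    by rewrite -[LHS](mulmxK uW) -(mulmxA _ M W) mulmx_ker mul0mx.
  by apply: submx_trans k2 _; apply/sub_kermxP; rewrite mulmxA mulmx_ker mul0mx.
exists (fun l => p l *m W), (fun l => q l *m W); split.
- by split; apply: hW.
- move=> l l0; rewrite mulmxA pq// -!mulmxA; congr (_ *m _).
  rewrite /bundle_sum /W !mulmx_block !mul0mx !mulmx0 !mul1mx !mulmx1.
  by rewrite !addr0 !add0r.
- by move=> l; apply: K.
- by move=> l; apply: K.
Qed.

Lemma poly_binomial (x : {poly C}) i : (size x <= k.+1)%N -> (i < k)%N ->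
  (forall j : nat, (j < k)%N -> j != i -> x`_j = 0) ->
  x = x`_i *: 'X^i + x`_k *: 'X^k.
Proof.
move=> sx ik x0; apply/polyP => j; rewrite coefD !coefZ !coefXn.
have [->|ji] := eqVneq j i.
  by rewrite (ltn_eqF ik) mulr1 mulr0 addr0.
rewrite mulr0 add0r; have [->|jk] := eqVneq j k; first by rewrite mulr1.
rewrite mulr0; have [jlt|kj] := ltnP j k; first exact: x0.
by rewrite nth_default// (leq_trans sx)// ltn_neqAle eq_sym jk.
Qed.

End Twistor.

Theorem mainTheorem5 (R : realType) (k : nat) (a : Cplx R)
    (hk : (3 <= k)%N) (ha : a != 0) :
  (forall i : nat,
     ((if odd k then (k + 1)./2 else k./2) <= i <= k - 1)%N ->
     forall x : {poly Cplx R},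
       (size x <= k.+1)%N -> x`_i != 0 ->
       (forall j : nat, (j <= k - 1)%N -> j != i -> x`_j = 0) ->
       (exists s : hol_section (twistor_patching k a), section_coefs s x) /\
       (forall s : hol_section (twistor_patching k a), section_coefs s x ->
          has_normal_bundle s
            (bundle_sum (line_bundle (2 - i%:Z)) (line_bundle i%:Z)))) /\
  (forall x : {poly Cplx R},
     (size x <= k.+1)%N -> x`_0 != 0 ->
     (forall j : nat, (1 <= j <= k - 1)%N -> x`_j = 0) ->
     (exists s : hol_section (twistor_patching k a), section_coefs s x) /\
     (forall s : hol_section (twistor_patching k a), section_coefs s x ->
        has_normal_bundle s
          (bundle_sum (line_bundle 0) (line_bundle 2)))).
Proof.
split=> [i iP x sx xi x0|x sx x0 xj].
  have [ik k2i] : (i < k)%N /\ (k <= 2 * i)%N.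
    move: iP; rewrite addn1 -[_./2]/(uphalf k) uphalf_half -[in (k <= _)%N](odd_double_half k).
    by case: odd; lia.
  have -> : x = x`_i *: 'X^i + x`_k *: 'X^k.
    by apply: poly_binomial => // j jk; apply: x0; lia.
  apply: (@binomial_sections R k a hk _ _ i ((a * x`_i ^+ 2) *: 'X^(2 * i - k)) 0) => //.
    exact: ltnW.
  move=> l l0.
  have E : l ^+ (k - 2) * l ^+ (2 * i - k) = (l ^+ i) ^+ 2 / l ^+ 2.
    rewrite -exprD -exprM; have -> : (k - 2 + (2 * i - k) = i * 2 - 2)%N by lia.
    by rewrite -[in RHS](@subnK 2 (i * 2)) ?exprD ?mulfK ?expf_neq0//; lia.
  by rewrite -[RHS]mulrA -E !hornerE /=; ring.
have k0 : (0 < k)%N by lia.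
have -> : x = x`_0 *: 'X^0 + x`_k *: 'X^k.
  by apply: poly_binomial => // j jk j0; apply: xj; lia.
have [|ex nb] := @binomial_sections R k a hk x`_0 x`_k 0%N 0 ((a * x`_0 ^+ 2) *: 'X^2)
    ha x0 (leq0n k).
  by move=> l l0; rewrite !hornerE /= expr0; field; rewrite ?l0.
by split=> // s /nb; rewrite subr0; exact: normal_bundle_swap.
Qed.
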